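(* Let $X=\prod_{p=1}^{n_0}X_p$ where each $X_p$ is a compact metric space of finite topological dimension $d_p$, and set $M=\sum_{p=1}^{n_0}d_p$. Let $\psi_{pq}:X_p\to[0,1]$ ($p=1,\dots,n_0$, $q=1,\dots,2M+1$) be continuous functions such that every $f\in C(X)$ can be written as $f(x_1,\dots,x_{n_0})=\sum_{q=1}^{2M+1}h_q\big(\sum_{p=1}^{n_0}\psi_{pq}(x_p)\big)$ with $h_q\in C(\mathbb{R})$, and set $s_q(x_1,\dots,x_{n_0})=\sum_{p=1}^{n_0}\psi_{pq}(x_p)$ and $F=(s_1,\dots,s_{2M+1}):X\to\mathbb{R}^{2M+1}$. Let $\mathcal{A}(X)\subset C(X)$ be a feature family containing $s_1,\dots,s_{2M+1}$. Assume $\sigma:\mathbb{R}\to\mathbb{R}$ is continuous and nonaffine, and that there exist $t_0\in\mathbb{R}$ and an open neighborhood $U$ of $t_0$ such that $\sigma$ is differentiable on $U$ and $\sigma'$ is continuous at $t_0$ with $\sigma'(t_0)\neq0$. Then for every $m\ge1$, every compact $K\subset X$, every $g\in C(K;\mathbb{R}^m)$ and every $\varepsilon>0$ there is $H\in\mathcal{N}^{(2M+m+3,m)}(X,\sigma;F)$ with $\sup_{x\in K}\|g(x)-H(x)\|_{\mathbb{R}^m}<\varepsilon$.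
   Context: Ostrand's extension of the Kolmogorov superposition theorem guarantees that functions $\psi_{pq}$ as in the claim exist. A classical deep feedforward network $\Phi:\mathbb{R}^n\to\mathbb{R}^m$ with activation $\sigma$ is a map $\Phi=T_{l+1}\circ\sigma\circ T_l\circ\cdots\circ\sigma\circ T_0$ with affine maps $T_0:\mathbb{R}^n\to\mathbb{R}^{k_0}$, $T_j:\mathbb{R}^{k_{j-1}}\to\mathbb{R}^{k_j}$, $T_{l+1}:\mathbb{R}^{k_l}\to\mathbb{R}^m$, $\sigma$ acting componentwise; its width is $\max_j k_j$, with arbitrary depth $l$. For $F=(f_1,\dots,f_n)$ with $f_i\in\mathcal{A}(X)$, $k\in\mathbb{N}$ and $m\ge1$, $\mathcal{N}^{(k,m)}(X,\sigma;F)$ denotes the set of all $H:X\to\mathbb{R}^m$ of the form $H=\Phi\circ F$ where $\Phi:\mathbb{R}^n\to\mathbb{R}^m$ is a classical deep feedforward network with activation $\sigma$ and width at most $k$. *)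

(* Defs.v *)
From HB Require Import structures.
From mathcomp Require Import all_boot all_order all_algebra.
From mathcomp Require Import all_classical all_reals all_analysis.
Set Implicit Arguments. Unset Strict Implicit. Unset Printing Implicit Defensive.
Import Order.TTheory GRing.Theory Num.Theory.
Import numFieldNormedType.Exports.
Local Open Scope classical_set_scope.
Local Open Scope ring_scope.

Definition covdim_le (T : topologicalType) (d : nat) : Prop :=
  forall (I : finType) (U : I -> set T),
    (forall i, open (U i)) -> (\bigcup_i U i = setT) ->
    exists (J : finType) (V : J -> set T),
      [/\ (forall j, open (V j)),
          \bigcup_j V j = setT,
          (forall j, exists i, V j `<=` U i) &
          (forall (x : T) (S : {set J}), (forall j, j \in S -> V j x) ->
             (#|S| <= d.+1)%N)].

Definition topdim (T : topologicalType) (d : nat) : Prop :=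
  covdim_le T d /\ (forall e, covdim_le T e -> (d <= e)%N).

(* Vectors of R^a are row vectors 'rV[R]_a.  A [layers R a b] is the chain
   of affine maps T_j (x |-> x *m W + c), each but the last followed by the
   componentwise activation. *)
Inductive layers (R : ringType) : nat -> nat -> Type :=
| LOut (a b : nat) : 'M[R]_(a, b) -> 'rV[R]_b -> layers R a b
| LHid (a c b : nat) : 'M[R]_(a, c) -> 'rV[R]_c -> layers R c b -> layers R a b.

Fixpoint layers_eval (R : ringType) (sigma : R -> R) (a b : nat)
  (N : layers R a b) : 'rV[R]_a -> 'rV[R]_b :=
  match N in layers _ a b return 'rV[R]_a -> 'rV[R]_b with
  | LOut _ _ W c => fun x => x *m W + c
  | LHid _ _ _ W c N' => fun x => layers_eval sigma N' (map_mx sigma (x *m W + c))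
  end.

Fixpoint layers_width (R : ringType) (a b : nat) (N : layers R a b) : nat :=
  match N with
  | LOut _ _ _ _ => 0%N
  | LHid _ c _ _ _ N' => maxn c (layers_width N')
  end.

(* a classical network has at least one hidden layer (l >= 0 in
   T_{l+1} o sigma o T_l o ... o sigma o T_0) *)
Definition has_hidden (R : ringType) (a b : nat) (N : layers R a b) : bool :=
  match N with LOut _ _ _ _ => false | LHid _ _ _ _ _ _ => true end.

Definition NN (R : ringType) (X : Type) (n : nat) (k m : nat) (sigma : R -> R)
  (F : X -> 'rV[R]_n) : set (X -> 'rV[R]_m) :=
  [set H | exists N : layers R n m,
      [/\ has_hidden N, (layers_width N <= k)%N &
          forall x, H x = layers_eval sigma N (F x)]].

Definition enorm (R : realType) (m : nat) (v : 'rV[R]_m) : R :=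
  Num.sqrt (\sum_(i < m) v ord0 i ^+ 2).

(* Main.v *)
(* A network of width [r + 1] can carry [r] registers: near [t0] a rescaled copy
   of [sigma] is close to the identity, and the remaining neuron adds
   [a * sigma (affine form of the other registers)] to one register.  The functions
   that can be added to a register form a closed space; averaging [sigma] twice
   over unit intervals gives a C^2 function with a nonzero second derivative
   somewhere, whose second difference quotients yield [t ^ 2].  Polarization gives
   products of two registers, a commutator of shears (as in Ben-Or and Cleve's
   straight-line programs) raises the degree using any other register as borrowed
   memory, and Weierstrass' theorem gives every continuous function of an input
   register.  With [2M + 1] inputs, [m] outputs and one auxiliary register the
   outputs accumulate the sums [sum_q h_q (s_q)] that represent a Tietze extension
   of [g]. *)
Require Import Defs.
From HB Require Import structures.
From mathcomp Require Import all_boot all_order all_algebra.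
From mathcomp Require Import all_classical all_reals all_analysis.
From mathcomp Require Import ring lra zify.
Import Order.TTheory GRing.Theory Num.Theory.
Import numFieldNormedType.Exports.
Local Open Scope classical_set_scope.
Local Open Scope ring_scope.

(** * Uniform continuity on compact sets *)

Section heine_cantor.
Context {R : realType} {V W : normedModType R}.

(** Compactness enters as the near-covering property for the filter of small positive radii. The
    point [y] may leave [K], as the output of an approximating network does later. *)
Lemma compact_continuous_modulus (f : V -> W) (K : set V) (eta : R) :
  compact K -> continuous f -> 0 < eta ->
  exists2 delta, 0 < delta &
    forall x y, K x -> `|x - y| < delta -> `|f x - f y| < eta.
Proof.
move=> /compact_near_coveringP cK cf eta0.
have [|delta /= delta0 Hd] := cK R (0^'+ : set_system R)
  (fun d x => forall y, `|x - y| < d -> `|f x - f y| < eta) _.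
  move=> x Kx.
  have /cvgrPdist_lt/(_ (eta / 2)) := cf x.
  rewrite divr_gt0// => /(_ isT) /nbhs_ballP[e /= e0 He].
  exists (ball x (e / 2), [set d | d < e / 2]) => /=.
    split; first by apply: nbhsx_ballx; rewrite divr_gt0.
    by apply: nbhs_right_lt; rewrite divr_gt0.
  case=> z d /= [xz de] y zy.
  have Hz : `|f x - f z| < eta / 2.
    apply: He; rewrite -ball_normE /= in xz *; apply: lt_trans xz _; lra.
  have Hy : `|f x - f y| < eta / 2.
    apply: He; rewrite -ball_normE /= in xz *.
    have := ler_distD z x y; lra.
  have := ler_distD (f x) (f z) (f y); rewrite (distrC (f z) (f x)); lra.
exists (delta / 2); first by rewrite divr_gt0.
move=> x y Kx; apply: (Hd (delta / 2)) => //=; last by rewrite divr_gt0.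
rewrite sub0r normrN gtr0_norm ?divr_gt0//; lra.
Qed.

End heine_cantor.

(** * Bernstein polynomials and Weierstrass' theorem *)

Section weierstrass.
Context {R : realType}.

(* The Bernstein polynomial of [k |-> g k], in recursive form: its value at [x]
   is the mean of [g] under the binomial law of parameters [n] and [x]. *)
Fixpoint bernstein (n : nat) (g : nat -> R) : {poly R} :=
  if n is n'.+1
  then 'X * bernstein n' (g \o succn) + (1 - 'X) * bernstein n' g
  else (g 0%N)%:P.

Lemma bernsteinS n g x : (bernstein n.+1 g).[x] =
  x * (bernstein n (g \o succn)).[x] + (1 - x) * (bernstein n g).[x].
Proof. by rewrite /= !hornerE. Qed.

Lemma bernstein_linear n a g g' x : (bernstein n (fun k => a * g k + g' k)).[x] =
  a * (bernstein n g).[x] + (bernstein n g').[x].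
Proof.
elim: n g g' => [|n IH] g g'; first by rewrite /= !hornerE.
rewrite !bernsteinS.
have -> : (fun k => a * g k + g' k) \o succn =
  (fun k => a * (g \o succn) k + (g' \o succn) k) by [].
rewrite !IH; ring.
Qed.

Lemma bernstein_cst n c x : (bernstein n (fun=> c)).[x] = c.
Proof.
elim: n => [|n IH]; first by rewrite /= hornerE.
have -> : bernstein n.+1 (fun=> c) = 'X * bernstein n (fun=> c)
  + (1 - 'X) * bernstein n (fun=> c) by [].
by rewrite hornerD !hornerM IH !hornerE; ring.
Qed.

Lemma bernstein_le n g g' x : 0 <= x <= 1 -> (forall k, (k <= n)%N -> g k <= g' k) ->
  (bernstein n g).[x] <= (bernstein n g').[x].
Proof.
move=> /andP[x0 x1]; elim: n g g' => [|n IH] g g' gg'.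
  by rewrite /= !hornerE; apply: gg'.
rewrite !bernsteinS lerD// ler_wpM2l ?subr_ge0//; apply: IH => k kn /=; apply: gg' => //.
exact: leqW.
Qed.

(** The offset [a] carries the induction: conditioning on one trial replaces it by [a + 1 - x] or
    [a - x], whose squares have mean [a ^+ 2 + x * (1 - x)]. *)
Lemma bernstein_variance n a x :
  (bernstein n (fun k => (k%:R + a - n%:R * x) ^+ 2)).[x] =
  n%:R * x * (1 - x) + a ^+ 2.
Proof.
elim: n a => [|n IH] a; first by rewrite /= hornerE; ring.
rewrite bernsteinS.
have -> : (fun k => (k%:R + a - n.+1%:R * x) ^+ 2) \o succn =
   (fun k => (k%:R + (a + 1 - x) - n%:R * x) ^+ 2).
  by apply/funext => k /=; rewrite -!natr1; congr (_ ^+ 2); ring.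
have -> : (fun k => (k%:R + a - n.+1%:R * x) ^+ 2) =
   (fun k => (k%:R + (a - x) - n%:R * x) ^+ 2).
  by apply/funext => k /=; rewrite -!natr1; congr (_ ^+ 2); ring.
rewrite !IH -natr1; ring.
Qed.

(** Chebyshev's argument: the error at a node is at most [eta / 2] near [x] by uniform continuity
    and is dominated by a parabola away from [x]; the mean of the parabola is a multiple of the
    variance. *)
Lemma weierstrass01 (f : R -> R) (eta : R) : continuous f -> 0 < eta ->
  exists p : {poly R}, forall x, 0 <= x <= 1 -> `|f x - p.[x]| <= eta.
Proof.
move=> cf eta0.
have cI : compact `[(0 : R), 1] by exact: segment_compact.
have [d d0 Hd] := compact_continuous_modulus f _ (eta / 2) cI cf
  ltac:(by rewrite divr_gt0).
have [C HC] : exists C, forall x, 0 <= x <= 1 -> `|f x| <= C.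
  have [|c _ cmax] := @EVT_max R (fun x => `|f x|) 0 1 ler01.
    by apply: continuous_subspaceT => x; apply: (cvg_norm (cf x)).
  by exists `|f c| => x x01; apply: cmax; rewrite in_itv.
have C0 : 0 <= C by apply: le_trans (HC 0 _); rewrite ?lexx ?ler01.
(* This makes [C / (n * d ^+ 2)] at most [eta]; the variance term will contribute at most half of
   that quotient. *)
pose n := (Num.truncn (C / (d ^+ 2 * eta))).+1.
have n0 : 0 < n%:R :> R by rewrite ltr0n.
have nC : C <= n%:R * d ^+ 2 * eta.
  have : C / (d ^+ 2 * eta) < n%:R by apply: truncnS_gt.
  rewrite ltr_pdivrMr ?mulr_gt0 ?exprn_gt0// => /ltW; lra.
pose g k : R := f (k%:R / n%:R).
exists (bernstein n g) => x x01.
(* The comparison [bernstein_le] is one-sided, so the error is bounded for both signs [c]. *)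
have key c : c = 1 \/ c = -1 ->
    c * f x - c * (bernstein n g).[x] <= eta.
  move=> cE.
  have -> : c * f x - c * (bernstein n g).[x] =
     (bernstein n (fun k => - c * g k + c * f x)).[x].
    by rewrite bernstein_linear bernstein_cst; ring.
  (* The parabola reaches the trivial error bound [2 * C] exactly at distance [d] between [x] and
     the node [k / n]. *)
  pose A := 2 * C / (n%:R * d) ^+ 2.
  have A0 : 0 <= A by rewrite /A mulr_ge0 ?mulr_ge0 ?invr_ge0 ?sqr_ge0.
  apply: (@le_trans _ _ (bernstein n
     (fun k => A * (k%:R + 0 - n%:R * x) ^+ 2 + eta / 2)).[x]).
    apply: bernstein_le => // k kn.
    have k01 : 0 <= (k%:R / n%:R : R) <= 1.
      by rewrite divr_ge0 ?ler0n//= ler_pdivrMr// mul1r ler_nat.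
    have -> : - c * g k + c * f x = c * (f x - g k) by ring.
    apply: (@le_trans _ _ `|f x - g k|).
      by case: cE => ->; rewrite ?mulN1r ?mul1r ?ler_norm // -normrN ler_norm.
    have [xk|xk] := ltP `|x - k%:R / n%:R| d.
      have /ltW := Hd x (k%:R / n%:R) ltac:(by rewrite /= in_itv) xk.
      by move/le_trans; apply; rewrite lerDr mulr_ge0 ?sqr_ge0.
    have le2C : `|f x - g k| <= 2 * C.
      have := ler_normB (f x) (g k); have := HC x x01; have := HC _ k01.
      rewrite -/(g k); lra.
    apply: (le_trans le2C).
    rewrite -[leLHS]addr0 lerD//; last by rewrite divr_ge0// ltW.
    rewrite /A mulrAC ler_pdivlMr ?exprn_gt0 ?mulr_gt0//.
    rewrite ler_wpM2l ?mulr_ge0//.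
    have -> : k%:R + 0 - n%:R * x = - (n%:R * (x - k%:R / n%:R)).
      by field; rewrite gt_eqF.
    rewrite sqrrN !exprMn ler_wpM2l ?sqr_ge0//.
    rewrite -[(x - _) ^+ 2]real_normK ?num_real// lerXn2r ?nnegrE//.
    exact: ltW.
  rewrite bernstein_linear bernstein_cst bernstein_variance expr0n/= addr0.
  suff : A * (n%:R * x * (1 - x)) <= eta / 2 by lra.
  have x4 : x * (1 - x) <= 1 / 4 by have := sqr_ge0 (x - 1 / 2); nra.
  apply: (@le_trans _ _ (A * (n%:R * (1 / 4)))).
    rewrite ler_wpM2l// -mulrA ler_wpM2l// ler0n//.
  rewrite /A exprMn.
  have -> : 2 * C / (n%:R ^+ 2 * d ^+ 2) * (n%:R * (1 / 4)) =
    C / (n%:R * d ^+ 2) / 2 by field; rewrite !gt_eqF.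
  rewrite ler_pM2r ?invr_gt0// ler_pdivrMr ?mulr_gt0 ?exprn_gt0//.
  by rewrite mulrC.
rewrite ler_norml; have := key 1 (or_introl erefl); have := key (-1) (or_intror erefl).
by move=> h1 h2; apply/andP; split; lra.
Qed.

Lemma weierstrass (f : R -> R) (B eta : R) : continuous f -> 0 < eta ->
  exists p : {poly R}, forall x, `|x| <= B -> `|f x - p.[x]| <= eta.
Proof.
move=> cf eta0; pose C := `|B| + 1.
have C0 : 0 < C by rewrite ltr_wpDl.
have [|p Hp] := weierstrass01 (fun t => f (2 * C * t - C)) eta _ eta0.
  move=> t; apply: (@continuous_comp _ _ _ (fun t => 2 * C * t - C) f);
    last exact: cf.
  apply: cvgB; last exact: cvg_cst.
  by apply: cvgM; [exact: cvg_cst|exact: cvg_id].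
exists (p \Po ((2 * C)^-1 *: 'X + 2^-1%:P)) => x xB.
rewrite horner_comp !hornerE.
have xC : - C <= x <= C.
  by rewrite -ler_norml; apply: (le_trans xB); rewrite /C; have := ler_norm B; lra.
have := Hp ((2 * C)^-1 * x + 2^-1).
have -> : 2 * C * ((2 * C)^-1 * x + 2^-1) - C = x by field; rewrite gt_eqF.
apply.
have -> : (2 * C)^-1 * x + 2^-1 = (x + C) / (2 * C) by field; rewrite gt_eqF.
apply/andP; split; first by apply: divr_ge0; lra.
by rewrite ler_pdivrMr ?mulr_gt0// mul1r; lra.
Qed.

End weierstrass.

(** * Antiderivatives and the mean value theorem *)

Section antiderivative.
Context {R : realType}.
Notation mu := (@lebesgue_measure R).

Lemma continuous_integrable_itv (f : R -> R) (a b : R) : continuous f ->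
  mu.-integrable `[a, b] (EFin \o f).
Proof.
move=> cf; apply: continuous_compact_integrable; first exact: segment_compact.
exact: continuous_subspaceT.
Qed.

(** Integrals over [[a, x]] need a base point to the left of [x], so the base point moves with [x].
    Subtracting the integral up to 0 removes the dependence on it, and near each point [Q] differs
    by a constant from an integral with fixed base point. *)
Lemma continuous_antiderivative (f : R -> R) : continuous f ->
  exists Q : R -> R, forall x : R, is_derive x 1 Q (f x).
Proof.
move=> cf.
pose I a x : R := \int[mu]_(t in `[a, x]) f t.
have IB a b x : b <= a -> a < x -> I b x - I a x = I b a.
  move=> ba ax; rewrite /I.
  have := @Rintegral_itvB R f (BLeft b) (BRight x) a.
  rewrite !bnd_simp => /(_ (continuous_integrable_itv f b x cf) ba (ltW ax)) H.
  rewrite -(@Rintegral_itv_obnd_cbnd R a (BRight x)); last first.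
    apply: integrableS (continuous_integrable_itv f a x cf) => //.
    by move=> t /=; rewrite !in_itv/= => /andP[/ltW -> ->].
  lra.
pose Q (x : R) := I (- (`|x| + 1)) x - I (- (`|x| + 1)) 0.
have QE (a x : R) : `|x| + 1 <= a -> Q x = I (- a) x - I (- a) 0.
  move=> xa; rewrite /Q.
  have := IB (- (`|x| + 1)) (- a) x; have := IB (- (`|x| + 1)) (- a) 0.
  have := normr_ge0 x; have := ler_norm (- x); rewrite normrN => h1 h2.
  move=> /(_ ltac:(lra) ltac:(lra)) h3 /(_ ltac:(lra) ltac:(lra)) h4.
  lra.
exists Q => x.
(* One base point that serves all [y] within distance 1 of [x], since then [|y| + 1 <= a]. *)
pose a : R := `|x| + 2.
have xa : - a < x by rewrite /a; have := ler_norm (- x); rewrite normrN; lra.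
have [dI I'] : derivable (I (- a)) x 1 /\ derive1 (I (- a)) x = f x.
  apply: (@continuous_FTC1_closed R f (- a) x (x + 1)) => //.
  - by rewrite ltrDl.
  - exact: continuous_integrable_itv.
  - exact: cf.
have dI' : is_derive x 1 (fun y => I (- a) y - I (- a) 0) (f x).
  have h : is_derive x 1 (I (- a)) (f x) by rewrite -I' derive1E; apply/derivableP.
  by apply: is_derive_eq; rewrite oppr0 addr0.
apply: (near_eq_is_derive _ dI').
near=> y; apply/esym/QE; rewrite /a.
suff : `|x - y| < 1 by have := ler_distD x y 0; rewrite !subr0 distrC; lra.
by near: y; apply/nbhs_ballP; exists 1 => /=.
Unshelve. all: by end_near.
Qed.

Lemma MVT_global (f df : R -> R) (a b : R) :
  (forall x : R, is_derive x 1 f (df x)) -> a <= b ->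
  exists2 c, a <= c <= b & f b - f a = df c * (b - a).
Proof.
move=> dfP ab.
have [|c cab E] := MVT_segment ab (fun x _ => dfP x) _.
  apply: continuous_subspaceT => x; apply: differentiable_continuous.
  by apply/derivable1_diffP; have [] := dfP x.
by exists c; first by rewrite in_itv in cab.
Qed.

End antiderivative.

(** * Continuous functions with vanishing second differences *)

Section midpoint_affine.
Context {R : realType}.

(** The defect [K] is additive and vanishes on the natural numbers, so its values at nonnegative
    points are values on [[0, 1]] and it is bounded; since [K (n * x) = n * K x], it is zero. *)
Lemma additive_continuous_linear (L : R -> R) : continuous L ->
  (forall x y, L (x + y) = L x + L y) -> forall x, L x = x * L 1.
Proof.
move=> cL LD.
pose K x := L x - x * L 1.
have KD x y : K (x + y) = K x + K y by rewrite /K LD; ring.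
have K0 : K 0 = 0 by have := KD 0 0; rewrite addr0; lra.
have K1 : K 1 = 0 by rewrite /K; ring.
have KMn n x : K (n%:R * x) = n%:R * K x.
  elim: n => [|n IH]; first by rewrite !mul0r.
  by rewrite -natr1 !mulrDl !mul1r KD IH.
have KN x : K (- x) = - K x by have := KD x (- x); rewrite subrr; lra.
have Kn n : K n%:R = 0 by rewrite -[n%:R]mulr1 KMn K1 mulr0.
have cK : continuous K.
  move=> x; apply: cvgB; first exact: cL.
  by apply: cvgM; [exact: cvg_id|exact: cvg_cst].
have [|c _ cmax] := @EVT_max R (fun x => `|K x|) 0 1 ler01.
  by apply: continuous_subspaceT => x; apply: (cvg_norm (cK x)).
have Kpos x : 0 <= x -> `|K x| <= `|K c|.
  move=> x0; have /andP[h1 h2] := truncn_itv x0.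
  have -> : K x = K (x - (Num.truncn x)%:R) by rewrite KD KN Kn subr0.
  by apply: cmax; rewrite in_itv/= subr_ge0 h1 /=; move: h2; rewrite -natr1; lra.
have Kbd x : `|K x| <= `|K c|.
  have [x0|x0] := leP 0 x; first exact: Kpos.
  by rewrite -normrN -KN Kpos// oppr_ge0 ltW.
move=> x; suff : K x = 0 by rewrite /K; lra.
apply/eqP; rewrite -normr_eq0; apply: contraT => Kx; have {}Kx : 0 < `|K x| by rewrite lt_def Kx normr_ge0.
pose n := (Num.truncn (`|K c| / `|K x|)).+1.
have : `|K c| / `|K x| < n%:R by apply: truncnS_gt.
rewrite ltr_pdivrMr// => h.
by have := Kbd (n%:R * x); rewrite KMn normrM normr_nat leNgt h.
Qed.

(** The second difference based at 0 gives [L (2 y) = 2 L y]; the one based at [2 x] with step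
    [y - x] gives the midpoint identity. Together they make [L] additive. *)
Lemma second_difference_zero_affine (f : R -> R) : continuous f ->
  (forall x h, f (x + h + h) - 2 * f (x + h) + f x = 0) ->
  exists a b, forall x, f x = a * x + b.
Proof.
move=> cf f0; pose L x := f x - f 0.
have L2 y : L (y + y) = 2 * L y by rewrite /L; have := f0 0 y; rewrite !add0r; lra.
have LD x y : L (x + y) = L x + L y.
  have := f0 (x + x) (y - x); have := L2 x; have := L2 y; rewrite /L.
  have -> : x + x + (y - x) + (y - x) = y + y by ring.
  have -> : x + x + (y - x) = x + y by ring.
  lra.
exists (L 1), (f 0) => x.
have := additive_continuous_linear L _ LD x; rewrite {1}/L mulrC => <-; first by rewrite /L; ring.
by move=> y; apply: cvgB; [exact: cf|exact: cvg_cst].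
Qed.

End midpoint_affine.

(** * Closed affine-invariant function spaces contain the square *)

Section closed_invariant_space.
Context {R : realType}.

(** Abstracts the functions of one affine form that networks can add to a register. The empty
    predicate qualifies, so the zero function is always obtained as [- f + f] from a known
    member. *)
Definition closed_invariant (P : (R -> R) -> Prop) :=
  [/\ forall a f g, P f -> P g -> P (fun t => a * f t + g t),
      forall w b f, P f -> P (fun t => f (w * t + b)) &
      forall f, continuous f ->
        (forall B eta, 0 < eta ->
           exists2 g, P g & forall t, `|t| <= B -> `|f t - g t| <= eta) ->
        P f].

Lemma is_derive_affine (Q f : R -> R) (w b : R) :
  (forall x : R, is_derive x 1 Q (f x)) ->
  forall x : R, is_derive x 1 (fun t => Q (w * t + b)) (w * f (w * x + b)).
Proof.
move=> dQ x.
have h : is_derive x 1 (fun t : R => w * t + b) w.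
  by apply: is_derive_eq; rewrite addr0 /GRing.scale/= mulr1.
have := @is_derive1_comp R Q (fun t : R => w * t + b) x (f (w * x + b)) w.
by move=> /(_ (dQ _) h); rewrite mulrC.
Qed.

Lemma derivative_continuous (Q f : R -> R) :
  (forall x : R, is_derive x 1 Q (f x)) -> continuous Q.
Proof.
move=> dQ x; apply: differentiable_continuous.
by apply/derivable1_diffP; have [] := dQ x.
Qed.

Lemma closed_invariant_sum (P : (R -> R) -> Prop) (n : nat) (F : nat -> R -> R) :
  closed_invariant P -> (exists f, P f) -> (forall i, P (F i)) ->
  P (fun t => \sum_(0 <= i < n) F i t).
Proof.
case=> PD _ _ [f Pf] PF; elim: n => [|n IH].
  have -> : (fun t => \sum_(0 <= i < 0) F i t) = (fun t => -1 * f t + f t).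
    by apply/funext => t; rewrite big_geq //; ring.
  exact: PD.
have -> : (fun t => \sum_(0 <= i < n.+1) F i t) =
  (fun t => 1 * F n t + \sum_(0 <= i < n) F i t).
  by apply/funext => t; rewrite big_nat_recr//= mul1r addrC.
exact: PD.
Qed.

(* The Riemann sums of [f] over [[t, t + 1]] converge locally uniformly in [t]. *)
Lemma closed_invariant_box (P : (R -> R) -> Prop) (f Q : R -> R) :
  closed_invariant P -> P f -> continuous f ->
  (forall x : R, is_derive x 1 Q (f x)) ->
  P (fun t => Q (1 * t + 1) - Q t).
Proof.
move=> CI Pf cf dQ; have [PD PA PL] := CI; apply: PL.
  move=> t; apply: cvgB; last exact: (derivative_continuous Q f dQ).
  exact: (derivative_continuous _ _ (is_derive_affine Q f 1 1 dQ)).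
move=> B eta eta0.
pose C := `|B| + 1.
have cK : compact `[- C, C] by exact: segment_compact.
have [d d0 Hd] := compact_continuous_modulus f _ eta cK cf eta0.
pose n := (Num.truncn d^-1).+1.
have n0 : 0 < n%:R :> R by rewrite ltr0n.
have nd : n%:R^-1 < d.
  have : d^-1 < n%:R by apply: truncnS_gt.
  by rewrite -[X in _ < X -> _]invrK ltf_pV2// posrE ?invr_gt0.
exists (fun t => \sum_(0 <= i < n) (n%:R^-1 * f (1 * t + i%:R / n%:R) + 0 * f t)).
  apply: (closed_invariant_sum P n (fun i t => _)) => //; first by exists f.
  move=> i; apply: (PD n%:R^-1 (fun t => f (1 * t + _)) (fun t => 0 * f t)).
    exact: PA.
  have -> : (fun t => 0 * f t) = (fun t => -1 * f t + f t) by apply/funext => t; ring.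
  exact: PD.
move=> t tB.
(* The increment of [Q] is telescoped over [n] intervals of length below [d]; on each, the mean
   value theorem gives a value of [f] close to the one at the left endpoint. *)
have -> : Q (1 * t + 1) - Q t =
    \sum_(0 <= i < n) (Q (t + i.+1%:R / n%:R) - Q (t + i%:R / n%:R)).
  rewrite telescope_sumr // mul0r addr0 divff ?mul1r//.
  by rewrite gt_eqF.
rewrite -sumrB big_mkord.
have -> : eta = \sum_(i < n) (eta / n%:R).
  by rewrite sumr_const card_ord -[RHS]mulr_natr divfK ?gt_eqF.
apply: (le_trans (ler_norm_sum _ _ _)); apply: ler_sum => i _.
set x := t + i%:R / n%:R.
have -> : t + i.+1%:R / n%:R = x + n%:R^-1 by rewrite /x -natr1; ring.
have xn : x <= x + n%:R^-1 by rewrite lerDl ltW// invr_gt0.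
have [c /andP[xc cx] ->] := MVT_global Q f x (x + n%:R^-1) dQ xn.
have -> : f c * (x + n%:R^-1 - x) - (n%:R^-1 * f (1 * t + i%:R / n%:R) + 0 * f t) =
  - (f x - f c) / n%:R by rewrite mul1r -/x; ring.
rewrite normrM normrN ger0_norm ?invr_ge0// ler_pM2r ?invr_gt0//.
apply/ltW/Hd; last first.
  by rewrite distrC ger0_norm ?subr_ge0//; lra.
have : 0 <= (i%:R / n%:R : R) <= 1.
  by rewrite divr_ge0 ?ler0n//= ler_pdivrMr// mul1r ler_nat ltnW.
rewrite /= in_itv/= /x /C => /andP[h1 h2].
have := ler_norm t; have := ler_norm (- t); rewrite normrN.
have := ler_norm B => *; apply/andP; split; lra.
Qed.

(** Two mean value theorems, the first for the symmetric sum [psi] and the second for [Q] on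
    [[a - c, a + c]], turn the remainder into [2 * c * x * (f e - f a)] with [e] close to [a]. *)
Lemma second_antiderivative_taylor (f Q G : R -> R) (a eta : R) : continuous f ->
  (forall x : R, is_derive x 1 Q (f x)) -> (forall x : R, is_derive x 1 G (Q x)) ->
  0 < eta -> exists2 delta, 0 < delta & forall x, `|x| < delta ->
    `|G (a + x) + G (a - x) - 2 * G a - x ^+ 2 * f a| <= eta * x ^+ 2.
Proof.
move=> cf dQ dG eta0.
have /cvgrPdist_lt/(_ (eta / 2)) := cf a.
rewrite divr_gt0// => /(_ isT) /nbhs_ballP[d /= d0 Hd].
exists d => // x; wlog x0 : x / 0 <= x.
  move=> W xd; have [/W|x0] := leP 0 x; first exact.
  have := W (- x); rewrite normrN oppr_ge0 ltW// opprK sqrrN [G _ + _]addrC.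
  exact.
move=> xd; rewrite ger0_norm// in xd.
pose psi y := G (1 * y + a) + G (-1 * y + a) - y ^+ 2 * f a.
have dpsi (y : R) : is_derive y 1 psi (1 * Q (1 * y + a) + -1 * Q (-1 * y + a) - 2 * y * f a).
  have h1 := is_derive_affine G Q 1 a dG y.
  have h2 := is_derive_affine G Q (-1) a dG y.
  apply: is_derive_eq.
  by rewrite scaler0 add0r /GRing.scale/=; ring.
have [c /andP[c0 cx] E] := MVT_global psi _ 0 x dpsi x0.
have ca : - c + a <= c + a by lra.
have [e /andP[ce ec] E'] := MVT_global Q f (- c + a) (c + a) dQ ca.
have -> : G (a + x) + G (a - x) - 2 * G a - x ^+ 2 * f a = psi x - psi 0.
  rewrite /psi !mul1r !mulN1r !(addrC _ a) oppr0 addr0 expr0n/=; ring.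
rewrite E !mul1r !mulN1r.
have -> : (Q (c + a) + - Q (- c + a) - 2 * c * f a) * (x - 0) =
  (2 * c * x) * (f e - f a).
  rewrite E'; ring.
rewrite normrM ger0_norm ?mulr_ge0//.
have : `|f e - f a| < eta / 2.
  rewrite distrC; apply: Hd; rewrite -ball_normE /= ltr_norml; apply/andP; split; lra.
move/ltW => h.
apply: (@le_trans _ _ (2 * c * x * (eta / 2))); first by rewrite ler_wpM2l ?mulr_ge0.
have : c * x <= x * x by rewrite ler_wpM2r.
by rewrite expr2; nra.
Qed.

(** [G] has second derivative [f] but need not satisfy [P]. Its unit second difference [F] does,
    being [f] averaged twice, and [F] has second derivative [c] at 0. Rescaled symmetric differences
    of [F] at 0 therefore tend to [t ^+ 2]. *)
Lemma closed_invariant_square_unit (P : (R -> R) -> Prop) (f : R -> R) :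
  closed_invariant P -> P f -> continuous f -> f 2 - 2 * f 1 + f 0 != 0 ->
  P (fun t => t ^+ 2).
Proof.
move=> CI Pf cf c0; set c := (X in X != 0) in c0.
have [PD PA PL] := CI.
have [Q dQ] := continuous_antiderivative f cf.
have cQ := derivative_continuous Q f dQ.
have [G dG] := continuous_antiderivative Q cQ.
pose f1 t := Q (1 * t + 1) - Q t.
have Pf1 : P f1 by exact: (closed_invariant_box P f).
pose G1 t := G (1 * t + 1) - G t.
have dG1 (x : R) : is_derive x 1 G1 (f1 x).
  have h1 := is_derive_affine G Q 1 1 dG x.
  by apply: is_derive_eq; rewrite mul1r.
have cf1 : continuous f1.
  move=> x; apply: cvgB; last exact: cQ.
  exact: (derivative_continuous _ _ (is_derive_affine Q f 1 1 dQ)).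
pose F t := G1 (1 * t + 1) - G1 t.
have PF : P F by exact: (closed_invariant_box P f1).
apply: PL; first by move=> t; apply: exprn_continuous.
move=> B eta eta0.
pose C := `|B| + 1.
have C0 : 0 < C by rewrite ltr_wpDl.
(* The three Taylor errors have weights 1, 2, 1, hence the 4; dividing by [e ^+ 2 * c] accounts for
   [c], and [|t| < C] for the square. *)
pose eta' := eta * `|c| / (4 * C ^+ 2).
have nc0 : 0 < `|c| by rewrite normr_gt0.
have eta'0 : 0 < eta' by rewrite divr_gt0 ?mulr_gt0 ?exprn_gt0.
have [d2 d20 H2] := second_antiderivative_taylor f Q G 2 eta' cf dQ dG eta'0.
have [d1 d10 H1] := second_antiderivative_taylor f Q G 1 eta' cf dQ dG eta'0.
have [d0 d00 H0] := second_antiderivative_taylor f Q G 0 eta' cf dQ dG eta'0.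
pose d := Num.min d2 (Num.min d1 d0).
have dpos : 0 < d by rewrite !lt_min d20 d10 d00.
(* The step [e] keeps [e * t] within the range of all three Taylor bounds. *)
have [e e0 eC] : exists2 e, 0 < e & e * C < d.
  exists (d / C / 2); first by rewrite !divr_gt0.
  by rewrite mulrAC divfK ?gt_eqF//; lra.
pose k := (e ^+ 2 * c)^-1.
exists (fun t => k * F (e * t + 0) + (k * F (- e * t + 0) + (- 2 * k * F (0 * t + 0) + 0 * F t))).
  apply: (PD k (fun t => F (e * t + 0))); first exact: PA.
  apply: (PD k (fun t => F (- e * t + 0))); first exact: PA.
  apply: (PD (- 2 * k) (fun t => F (0 * t + 0))); first exact: PA.
  have -> : (fun t => 0 * F t) = (fun t => -1 * F t + F t) by apply/funext => t; ring.
  exact: PD.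
move=> t tB.
have tC : `|t| < C by apply: (le_lt_trans tB); have := ler_norm B; rewrite /C; lra.
pose x := e * t.
have xd : `|x| < d.
  apply: le_lt_trans eC; rewrite normrM gtr0_norm// ler_pM2l//; exact: ltW.
move: (xd); rewrite !lt_min => /and3P[/H2 {}H2 /H1 {}H1 /H0 {}H0].
have ec0 : 0 < e ^+ 2 * `|c| by rewrite mulr_gt0 ?exprn_gt0.
rewrite -(ler_pM2l ec0).
rewrite -[e ^+ 2 in leLHS]ger0_norm ?sqr_ge0// -!normrM.
(* The second difference over the base points 2, 1, 0 of the three Taylor remainders. *)
have E2 : (G (2 + x) + G (2 - x) - 2 * G 2 - x ^+ 2 * f 2)
   - 2 * (G (1 + x) + G (1 - x) - 2 * G 1 - x ^+ 2 * f 1)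
   + (G (0 + x) + G (0 - x) - 2 * G 0 - x ^+ 2 * f 0) =
   F x + F (- x) - 2 * F 0 - x ^+ 2 * c.
  rewrite /F /G1 /c.
  have -> : 1 * (1 * x + 1) + 1 = 2 + x by ring.
  have -> : 1 * (1 * - x + 1) + 1 = 2 - x by ring.
  have -> : 1 * (1 * 0 + 1) + 1 = 2 :> R by ring.
  have -> : 1 * x + 1 = 1 + x by ring.
  have -> : 1 * - x + 1 = 1 - x by ring.
  have -> : 1 * 0 + 1 = 1 :> R by ring.
  by rewrite !add0r; ring.
have -> : e ^+ 2 * c * (t ^+ 2 - (k * F (e * t + 0) + (k * F (- e * t + 0)
    + (- 2 * k * F (0 * t + 0) + 0 * F t)))) =
    - (F x + F (- x) - 2 * F 0 - x ^+ 2 * c).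
  have -> : e * t + 0 = x by rewrite addr0.
  have -> : - e * t + 0 = - x by rewrite addr0 mulNr.
  have -> : 0 * t + 0 = 0 by ring.
  have -> : t = x / e by rewrite /x; field; rewrite gt_eqF.
  by rewrite /k; field; rewrite c0 gt_eqF.
rewrite normrN -E2.
apply: (@le_trans _ _ (4 * eta' * x ^+ 2)).
  rewrite ler_norml; move: H2 H1 H0; rewrite !ler_norml.
  move=> /andP[? ?] /andP[? ?] /andP[? ?]; apply/andP; split; lra.
have -> : 4 * eta' * x ^+ 2 = (e ^+ 2 * `|c| * eta) * (t ^+ 2 / C ^+ 2).
  by rewrite /eta' /x; field; rewrite gt_eqF.
rewrite ger_pMr ?mulr_gt0 ?exprn_gt0//.
rewrite ler_pdivrMr ?exprn_gt0// mul1r -[t ^+ 2]real_normK ?num_real//.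
by apply: lerXn2r; rewrite ?nnegrE ?normr_ge0 ?ltW.
Qed.

(** A nonaffine [f] has a nonzero second difference; an affine substitution moves its nodes to 0, 1,
    2. *)
Lemma closed_invariant_square (P : (R -> R) -> Prop) (f : R -> R) :
  closed_invariant P -> P f -> continuous f ->
  ~ (exists a b, forall t, f t = a * t + b) -> P (fun t => t ^+ 2).
Proof.
move=> CI Pf cf naff.
have [x [h fxh]] : exists x h, f (x + h + h) - 2 * f (x + h) + f x != 0.
  apply: contrapT => H; apply: naff; apply: second_difference_zero_affine => // x h.
  by apply/eqP; apply: contrapT => /negP fxh; apply: H; exists x, h.
have [_ PA _] := CI.
apply: (closed_invariant_square_unit P (fun t => f (h * t + x)) CI).
- exact: PA.
- move=> t; apply: (@continuous_comp _ _ _ (fun t => h * t + x) f); last exact: cf.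
  by apply: cvgD; [apply: cvgM; [exact: cvg_cst|exact: cvg_id]|exact: cvg_cst].
- have -> : h * 2 + x = x + h + h by ring.
  by rewrite mulr1 mulr0 add0r (addrC h).
Qed.

End closed_invariant_space.

(** * Row vectors under the maximum norm *)

Section row_vectors.
Context {R : realType}.

Lemma rV_norm_leP {n : nat} (x : 'rV[R]_n) (e : R) : 0 <= e ->
  (`|x| <= e) <-> (forall i, `|x ord0 i| <= e).
Proof.
move=> e0; rewrite [X in X <= _ <-> _]/Num.norm /= mx_normrE; split => [H i|H].
  by apply: le_trans H; apply/bigmax_geP; right; exists (ord0, i).
by apply/bigmax_leP; split => // -[i j] _ /=; rewrite (ord1 i).
Qed.

Lemma compact_rV_ball {n : nat} (B : R) : compact [set x : 'rV[R]_n | `|x| <= B].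
Proof.
apply: bounded_closed_compact.
  by exists B; split; [exact: num_real|move=> C BC x /= xB; rewrite (le_trans xB)// ltW].
apply: (@closed_comp _ _ (fun x : 'rV[R]_n => `|x|) [set t | t <= B]).
  by move=> x _; exact: norm_continuous.
exact: closed_le.
Qed.

Lemma continuous_rV_bounded {n : nat} {V : normedModType R} (f : 'rV[R]_n -> V) (B : R) :
  continuous f -> exists2 C, 0 <= C & forall x, `|x| <= B -> `|f x| <= C.
Proof.
move=> cf.
have /compact_bounded[C [_ HC]] : compact (f @` [set x | `|x| <= B]).
  by apply: continuous_compact (compact_rV_ball B); exact: continuous_subspaceT.
exists (`|C| + 1) => [|x xB]; first by rewrite addr_ge0.
by apply: HC; [have := ler_norm C; lra|exists x].
Qed.

Lemma continuous_mulmx_col {n : nat} (w : 'cV[R]_n) :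
  continuous (fun x : 'rV[R]_n => (x *m w) ord0 ord0).
Proof.
have -> : (fun x : 'rV[R]_n => (x *m w) ord0 ord0) =
    (fun x => \sum_i x ord0 i * w i ord0) by apply/funext => x; rewrite mxE.
elim: (index_enum _) => [|i s IH].
  under eq_fun do rewrite big_nil.
  exact: cst_continuous.
under eq_fun do rewrite big_cons.
move=> x.
apply: (@continuousD R R _ (fun x : 'rV[R]_n => x ord0 i * w i ord0) _ x _ (IH x)).
apply: (@continuousM R _ (fun x : 'rV[R]_n => x ord0 i) (fun=> w i ord0) x).
  exact: coord_continuous.
exact: cst_continuous.
Qed.

End row_vectors.

(** * Composition of networks and of approximations *)

Section networks.
Context {R : realType}.
Variables (sigma : R -> R) (k : nat).

(** The output map of [N] is merged with the first affine map of [N'], so no extra hidden layer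
    appears and the width is a maximum. *)
Lemma layers_comp {a b c : nat} (N : layers R a b) (N' : layers R b c) :
  exists N'' : layers R a c,
  [/\ has_hidden N'' = has_hidden N || has_hidden N',
      (layers_width N'' <= maxn (layers_width N) (layers_width N'))%N &
      forall x, layers_eval sigma N'' x = layers_eval sigma N' (layers_eval sigma N x)].
Proof.
elim: N c N' => {a b} [a b W d|a e b W d N IH] c N'.
  case: N' W d => {b c} [b c W' d'|b e c W' d' N'] W d.
    exists (LOut (W *m W') (d *m W' + d')); split => // x /=.
    by rewrite mulmxDl mulmxA addrA.
  exists (LHid (W *m W') (d *m W' + d') N'); split => [||x] //=; first by rewrite max0n.
  by rewrite mulmxDl mulmxA addrA.
have [N'' [_ w E]] := IH c N'.
exists (LHid W d N''); split => //=.
by rewrite geq_max -maxnA leq_max leqnn/= leq_max w orbT.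
Qed.

Definition network {a b : nat} (f : 'rV[R]_a -> 'rV[R]_b) : Prop :=
  exists N : layers R a b, [/\ has_hidden N, (layers_width N <= k)%N &
    forall x, f x = layers_eval sigma N x].

Lemma network_comp {a b c : nat} (f : 'rV[R]_a -> 'rV[R]_b) (g : 'rV[R]_b -> 'rV[R]_c) :
  network f -> network g -> network (g \o f).
Proof.
move=> [N [hN wN fE]] [N' [hN' wN' gE]].
have [N'' [h w E]] := layers_comp N N'.
exists N''; split; first by rewrite h hN.
    by apply: leq_trans w _; rewrite geq_max wN.
by move=> x /=; rewrite E gE fE.
Qed.

Lemma network_affine {a b c d : nat} (f : 'rV[R]_b -> 'rV[R]_c)
    (W : 'M[R]_(a, b)) (W' : 'M[R]_(c, d)) :
  network f -> network (fun x => f (x *m W) *m W').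
Proof.
move=> [N [hN wN fE]].
have [N1 [h1 w1 E1]] := layers_comp (LOut W 0) N.
have [N2 [h2 w2 E2]] := layers_comp N1 (LOut W' 0).
exists N2; split; first by rewrite h2 h1 hN orbT.
  apply: leq_trans w2 _; rewrite maxn0; apply: leq_trans w1 _.
  by rewrite max0n.
by move=> x; rewrite E2 E1 fE /= !addr0.
Qed.

Definition approximable {a b : nat} (f : 'rV[R]_a -> 'rV[R]_b) : Prop :=
  forall B eta, 0 < eta ->
  exists2 g, network g & forall x, `|x| <= B -> `|f x - g x| <= eta.

Lemma approximable_comp {a b c : nat} (f : 'rV[R]_a -> 'rV[R]_b)
    (g : 'rV[R]_b -> 'rV[R]_c) :
  continuous f -> continuous g -> approximable f -> approximable g ->
  approximable (g \o f).
Proof.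
move=> cf cg Af Ag B eta eta0.
have [C C0 HC] := continuous_rV_bounded f B cf.
have eta20 : 0 < eta / 2 by rewrite divr_gt0.
have [d d0 Hd] := compact_continuous_modulus g _ _ (compact_rV_ball C) cg eta20.
(* The bound 1 keeps [f' x] in the ball of radius [C + 1], where [g'] is controlled; [d / 2] puts it
   strictly within the modulus of [g]. *)
have m0 : 0 < Num.min (d / 2) 1 by rewrite lt_min divr_gt0 ?ltr01.
have [f' nf' ff'] := Af B _ m0.
have [g' ng' gg'] := Ag (C + 1) _ eta20.
exists (g' \o f'); first exact: network_comp.
move=> x xB /=.
have := ff' x xB; rewrite le_min => /andP[h1 h2].
have fxC := HC x xB.
have /Hd h3 : `|f x| <= C by [].
have {}h3 := h3 (f' x) ltac:(lra).
have h4 : `|g (f' x) - g' (f' x)| <= eta / 2.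
  apply: gg'; have := lerB_dist (f' x) (f x); rewrite distrC; lra.
by have := ler_distD (g (f' x)) (g (f x)) (g' (f' x)); lra.
Qed.

End networks.

(** * The rescaled activation is close to the identity *)

Section activation_identity.
Context {R : realType}.

Lemma derivable_remainder (f : R -> R) (a eta : R) : derivable f a 1 -> 0 < eta ->
  exists2 d, 0 < d & forall y, `|y| < d ->
    `|f (y + a) - f a - y * derive1 f a| <= eta * `|y|.
Proof.
move=> df eta0.
have cf : h^-1 *: (f (h + a) - f a) @[h --> (0 : R)^'] --> derive1 f a.
  have df' := df; rewrite /derivable in df'.
  under eq_fun do rewrite -[X in f (X + _)]mulr1.
  by rewrite derive1E; exact: df'.
have /cvgrPdist_lt/(_ _ eta0) := cf.
move=> /nbhs_ballP[d /= d0 Hd]; exists d => // y yd.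
have [->|y0] := eqVneq y 0; first by rewrite add0r mul0r !subrr normr0 mulr0.
have := Hd y; rewrite -ball_normE /= sub0r normrN => /(_ yd y0) /ltW h.
have -> : f (y + a) - f a - y * derive1 f a =
   - (derive1 f a - y^-1 * (f (y + a) - f a)) * y by field.
by rewrite normrM normrN ler_wpM2r.
Qed.

(** For small [h] the first-order remainder at [h * t] is at most [eta * |s| / C] times [|h * t|];
    division by [h * s] cancels [h] and leaves at most [eta]. *)
Lemma rescaled_activation (f : R -> R) (a B eta : R) :
  derivable f a 1 -> derive1 f a != 0 -> 0 < eta ->
  exists2 h, h != 0 & forall t, `|t| <= B ->
    `|t - (h * derive1 f a)^-1 * (f (h * t + a) - f a)| <= eta.
Proof.
move=> df; set s := derive1 f a => s0 eta0.
pose C := `|B| + 1; have C0 : 0 < C by rewrite ltr_wpDl.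
have ns0 : 0 < `|s| by rewrite normr_gt0.
have e0 : 0 < eta * `|s| / C by rewrite divr_gt0 ?mulr_gt0.
have [d d0 Hd] := derivable_remainder f a _ df e0.
have [h h0 hC] : exists2 h, 0 < h & h * C = d.
  by exists (d / C); rewrite ?divr_gt0// divfK ?gt_eqF.
exists h => [|t tB]; first by rewrite gt_eqF.
have tC : `|t| < C by apply: (le_lt_trans tB); have := ler_norm B; rewrite /C; lra.
have /Hd : `|h * t| < d.
  by rewrite normrM gtr0_norm// -hC ltr_pM2l.
rewrite -/s.
have -> : t - (h * s)^-1 * (f (h * t + a) - f a) =
  - (h * s)^-1 * (f (h * t + a) - f a - h * t * s) by field; rewrite s0 gt_eqF.
rewrite (normrM (- _)) normrN normfV !normrM (gtr0_norm h0) => H.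
rewrite mulrC ler_pdivrMr ?mulr_gt0//; apply: (le_trans H).
have -> : eta * `|s| / C * (h * `|t|) = eta * (h * `|s|) * (`|t| / C) by ring.
rewrite ger_pMr ?mulr_gt0// ler_pdivrMr// mul1r; exact: ltW.
Qed.

End activation_identity.

(** * Shears of the register space *)

Section registers.
Context {R : realType}.
Variables (sigma : R -> R) (t0 : R) (r : nat).
Hypotheses (sigma_cont : continuous sigma) (sigma_derivable : derivable sigma t0 1)
  (sigma_slope : derive1 sigma t0 != 0).

Local Notation approximable := (@approximable R sigma r.+1 r r).

(* All [r] registers are carried by rescaled copies of [sigma] near [t0], which
   leaves one neuron free to evaluate [sigma] on an affine form. *)
Lemma approximable_neuron (w : 'cV[R]_r) (b : R) (v : 'rV[R]_r) :
  approximable (fun x => x + sigma ((x *m w) ord0 ord0 + b) *: v).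
Proof.
move=> B eta eta0.
have [h h0 Hh] := rescaled_activation sigma t0 B eta sigma_derivable sigma_slope eta0.
set s := derive1 sigma t0 in Hh *.
(* The first hidden neuron evaluates the affine form, the other [r] read the registers scaled by [h]
   around [t0]; the output layer undoes the scaling. *)
pose L : layers R r r :=
  LHid (row_mx w h%:M) (row_mx b%:M (const_mx t0))
    (LOut (col_mx v ((h * s)^-1)%:M) (const_mx (- ((h * s)^-1 * sigma t0)))).
exists (layers_eval sigma L); first by exists L; split => //=; rewrite maxn0.
move=> x xB; apply/rV_norm_leP; [exact: ltW|move=> i].
have -> : layers_eval sigma L x =
    sigma ((x *m w) ord0 ord0 + b) *: v +
    (h * s)^-1 *: map_mx sigma (x *m h%:M + const_mx t0)
    + const_mx (- ((h * s)^-1 * sigma t0)).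
  rewrite /= mul_mx_row add_row_mx map_row_mx mul_row_col mul_mx_scalar.
  congr (_ + _ + _).
  have -> : map_mx sigma (x *m w + b%:M) = (sigma ((x *m w) ord0 ord0 + b))%:M.
    by apply/matrixP => i' j'; rewrite !ord1 !mxE/= !mulr1n.
  by rewrite mul_scalar_mx.
rewrite mul_mx_scalar !mxE.
have -> : x ord0 i + sigma (\sum_j x ord0 j * w j ord0 + b) * v ord0 i -
   (sigma (\sum_j x ord0 j * w j ord0 + b) * v ord0 i +
    (h * s)^-1 * sigma (h * x ord0 i + t0) + - ((h * s)^-1 * sigma t0)) =
  x ord0 i - (h * s)^-1 * (sigma (h * x ord0 i + t0) - sigma t0) by ring.
have B0 : 0 <= B by apply: le_trans xB.
by apply: Hh; move/(rV_norm_leP x B B0): xB.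
Qed.

Local Notation e_ j := (delta_mx ord0 j : 'rV[R]_r).

(** Since [phi] does not read register [j], the map is a shear: shears on the same register compose
    by adding their functions, and [- phi] undoes [phi]. *)
Definition addable (j : 'I_r) (phi : 'rV[R]_r -> R) : Prop :=
  [/\ continuous phi, forall x t, phi (x + t *: e_ j) = phi x &
      approximable (fun x => x + phi x *: e_ j)].

Lemma continuous_shear (j : 'I_r) (phi : 'rV[R]_r -> R) :
  continuous phi -> continuous (fun x : 'rV[R]_r => x + phi x *: e_ j).
Proof.
move=> cphi x; apply: (@continuousD R _ _ id (fun x => phi x *: e_ j) x).
  exact: cvg_id.
exact: (@continuousZr_tmp _ _ _ phi (e_ j) x (cphi x)).
Qed.

Lemma addable_neuron (j : 'I_r) (w : 'cV[R]_r) (a b : R) : w j ord0 = 0 ->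
  addable j (fun x => a * sigma ((x *m w) ord0 ord0 + b)).
Proof.
move=> wj; split.
- move=> x; apply: continuousM; first exact: cst_continuous.
  apply: (@continuous_comp _ _ _ (fun x : 'rV[R]_r => (x *m w) ord0 ord0 + b) sigma);
    last exact: sigma_cont.
  by apply: continuousD; [exact: continuous_mulmx_col|exact: cst_continuous].
- move=> x t; congr (_ * sigma (_ + _)).
  by rewrite mulmxDl -scalemxAl -rowE !mxE wj mulr0 addr0.
- have -> : (fun x => x + a * sigma ((x *m w) ord0 ord0 + b) *: e_ j) =
     (fun x : 'rV[R]_r => x + sigma ((x *m w) ord0 ord0 + b) *: (a *: e_ j)).
    by apply/funext => x; rewrite scalerA mulrC.
  exact: approximable_neuron.
Qed.

Lemma addableD (j : 'I_r) (phi psi : 'rV[R]_r -> R) :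
  addable j phi -> addable j psi -> addable j (fun x => phi x + psi x).
Proof.
move=> [cphi iphi aphi] [cpsi ipsi apsi]; split.
- by move=> x; apply: continuousD; [exact: cphi|exact: cpsi].
- by move=> x t; rewrite iphi ipsi.
- have -> : (fun x => x + (phi x + psi x) *: e_ j) =
     (fun x => x + psi x *: e_ j) \o (fun x => x + phi x *: e_ j).
    by apply/funext => x /=; rewrite ipsi scalerDl addrA.
  by apply: approximable_comp => //; exact: continuous_shear.
Qed.

Lemma norm_delta_le1 (j : 'I_r) : `|e_ j| <= 1.
Proof.
apply/rV_norm_leP => // i; rewrite mxE eqxx /=.
by case: (_ == _); rewrite ?normr1 ?normr0 ?ler01.
Qed.

Lemma addable_limit (j : 'I_r) (phi : 'rV[R]_r -> R) :
  continuous phi -> (forall x t, phi (x + t *: e_ j) = phi x) ->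
  (forall B eta, 0 < eta ->
     exists2 psi, addable j psi & forall x, `|x| <= B -> `|phi x - psi x| <= eta) ->
  addable j phi.
Proof.
move=> cphi iphi H; split => // B eta eta0.
have eta20 : 0 < eta / 2 by rewrite divr_gt0.
have [psi [_ _ apsi] Hpsi] := H B _ eta20.
have [g ng Hg] := apsi B _ eta20.
exists g => // x xB.
have := Hg x xB; have := Hpsi x xB => h1 h2.
have := ler_distD (x + psi x *: e_ j) (x + phi x *: e_ j) (g x).
have -> : x + phi x *: e_ j - (x + psi x *: e_ j) = (phi x - psi x) *: e_ j.
  by rewrite opprD addrACA subrr add0r scalerBl.
rewrite normrZ => h3.
have : `|phi x - psi x| * `|e_ j| <= `|phi x - psi x|.
  by rewrite ler_piMr// norm_delta_le1.
lra.
Qed.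

End registers.

(** * From squares to arbitrary continuous functions of a register *)

Section register_programs.
Context {R : realType}.
Variables (sigma : R -> R) (t0 : R) (r : nat).
Hypotheses (sigma_cont : continuous sigma) (sigma_derivable : derivable sigma t0 1)
  (sigma_slope : derive1 sigma t0 != 0)
  (sigma_nonaffine : ~ exists a b : R, forall t, sigma t = a * t + b).

Local Notation addable := (@addable R sigma r).
Local Notation approximable := (@approximable R sigma r.+1 r r).
Local Notation e_ j := (delta_mx ord0 j : 'rV[R]_r).

(** The functions whose multiples, at every affine form that ignores register [j], can be added to
    it form a closed invariant space. It contains the nonaffine [sigma], hence the square. *)
Lemma addable_square (j : 'I_r) (w : 'cV[R]_r) (a b : R) : w j ord0 = 0 ->
  addable j (fun x => a * ((x *m w) ord0 ord0 + b) ^+ 2).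
Proof.
pose P (f : R -> R) := continuous f /\ forall (w : 'cV[R]_r) (a b : R),
  w j ord0 = 0 -> addable j (fun x => a * f ((x *m w) ord0 ord0 + b)).
suff : P (fun t => t ^+ 2) by move=> [_ +] wj => /(_ w a b wj).
apply: (closed_invariant_square P sigma) => //; last first.
  by split => // w' a' b'; apply: addable_neuron sigma_derivable sigma_slope _ _ _ _.
split.
- move=> c f g [cf Pf] [cg Pg]; split.
    by move=> t; apply: cvgD (cg t); apply: cvgM (cf t); exact: cvg_cst.
  move=> w' a' b' wj.
  have -> : (fun x : 'rV_r => a' * (c * f ((x *m w') ord0 ord0 + b') +
      g ((x *m w') ord0 ord0 + b'))) =
    (fun x => a' * c * f ((x *m w') ord0 ord0 + b') +
      a' * g ((x *m w') ord0 ord0 + b')).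
    by apply/funext => x; ring.
  by apply: addableD; [exact: Pf|exact: Pg].
- move=> c d f [cf Pf]; split.
    move=> t; apply: (@continuous_comp _ _ _ (fun t => c * t + d) f); last exact: cf.
    by apply: cvgD; [apply: cvgM; [exact: cvg_cst|exact: cvg_id]|exact: cvg_cst].
  move=> w' a' b' wj.
  have -> : (fun x : 'rV_r => a' * f (c * ((x *m w') ord0 ord0 + b') + d)) =
    (fun x => a' * f ((x *m (c *: w')) ord0 ord0 + (c * b' + d))).
    apply/funext => x; rewrite -scalemxAr [in RHS]mxE; congr (_ * f _); ring.
  by apply: Pf; rewrite mxE wj mulr0.
- move=> f cf H; split => // w' a' b' wj.
  pose l (x : 'rV[R]_r) := (x *m w') ord0 ord0 + b'.
  have cl : continuous l.
    by move=> x; apply: continuousD; [exact: continuous_mulmx_col|exact: cst_continuous].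
  apply: addable_limit.
  + move=> x; apply: continuousM; first exact: cst_continuous.
    by apply: (@continuous_comp _ _ _ l f); [exact: cl|exact: cf].
  + move=> x t; congr (_ * f (_ + _)).
    by rewrite mulmxDl -scalemxAl -rowE !mxE wj mulr0 addr0.
  + move=> B eta eta0.
    have [C C0 HC] := continuous_rV_bounded l B cl.
    have a0 : 0 < `|a'| + 1 by rewrite ltr_wpDl.
    have [g [_ Pg] Hg] := H C (eta / (`|a'| + 1)) (divr_gt0 eta0 a0).
    exists (fun x => a' * g (l x)); first exact: Pg.
    move=> x xB; rewrite -mulrBr normrM.
    apply: (@le_trans _ _ (`|a'| * (eta / (`|a'| + 1)))).
      by rewrite ler_wpM2l//; apply: Hg; exact: HC.
    by rewrite mulrCA ger_pMr// ler_pdivrMr// mul1r lerDl.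
Qed.

Lemma addable_cst (j : 'I_r) (c : R) : addable j (fun=> c).
Proof.
have -> : (fun=> c) = (fun x : 'rV[R]_r => c * ((x *m (0 : 'cV_r)) ord0 ord0 + 1) ^+ 2).
  by apply/funext => x; rewrite mulmx0 mxE; ring.
by apply: addable_square; rewrite mxE.
Qed.

(** Polarization: the squares of the sum and of the difference of the two registers differ by four
    times the product. *)
Lemma addable_product (j k l : 'I_r) (c : R) : k != j -> l != j ->
  addable j (fun x => c * (x ord0 k * x ord0 l)).
Proof.
move=> kj lj.
pose w s : 'cV[R]_r := delta_mx k ord0 + s *: delta_mx l ord0.
have wE x s : (x *m w s) ord0 ord0 = x ord0 k + s * x ord0 l.
  by rewrite mulmxDr -scalemxAr -!colE !mxE.
have -> : (fun x : 'rV[R]_r => c * (x ord0 k * x ord0 l)) =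
   (fun x => c / 4 * ((x *m w 1) ord0 ord0 + 0) ^+ 2 +
             - (c / 4) * ((x *m w (-1)) ord0 ord0 + 0) ^+ 2).
  by apply/funext => x; rewrite !wE; field.
have wj s : w s j ord0 = 0.
  by rewrite !mxE ![j == _]eq_sym (negbTE kj) (negbTE lj)/= mulr0 addr0.
by apply: addableD; apply: addable_square.
Qed.

(* The register [u] need not be clean: conjugating [r_u += phi] by
   [r_j -= r_k r_u] adds [r_k * phi] to [r_j] and restores [r_u]. *)
Lemma addable_commutator (j u k : 'I_r) (phi : 'rV[R]_r -> R) :
  u != j -> k != j -> k != u -> (forall x t, phi (x + t *: e_ j) = phi x) ->
  addable u phi -> addable u (fun x => - phi x) ->
  addable j (fun x => x ord0 k * phi x).
Proof.
move=> uj kj ku phij [cphi phiu aphi] [_ _ aNphi].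
have [cP _ aP] := addable_product j k u 1 kj uj.
have [cNP _ aNP] := addable_product j k u (-1) kj uj.
split.
- by move=> x; apply: continuousM; [exact: coord_continuous|exact: cphi].
- by move=> x t; rewrite phij !mxE eqxx (negbTE kj)/= mulr0 addr0.
have cNphi : continuous (fun x : 'rV[R]_r => - phi x) by move=> x; apply: continuousN; exact: cphi.
pose S (i : 'I_r) (psi : 'rV[R]_r -> R) := fun x : 'rV[R]_r => x + psi x *: e_ i.
(* The rightmost map runs first. Register [j] receives [- r_k * r_u] and then [r_k * (r_u + phi)];
   the last shear restores register [u]. *)
have -> : (fun x : 'rV[R]_r => x + (x ord0 k * phi x) *: e_ j) =
  S u (fun x => - phi x) \o (S j (fun x => 1 * (x ord0 k * x ord0 u)) \o
  (S u phi \o S j (fun x => -1 * (x ord0 k * x ord0 u)))).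
  apply/funext => x; rewrite /S /=.
  rewrite !(phij, phiu); apply/rowP => i.
  rewrite !mxE !eqxx (negbTE kj) (negbTE ku) (negbTE uj) /=; ring.
have cS i psi : continuous psi -> continuous (S i psi) by exact: continuous_shear.
have cC (f g : 'rV[R]_r -> 'rV[R]_r) :
    continuous f -> continuous g -> continuous (g \o f).
  by move=> cf cg x; apply: continuous_comp; [exact: cf|exact: cg].
apply: approximable_comp => //; [|exact: cS|].
  by apply: (cC _ _ (cC _ _ _ _)); exact: cS.
apply: approximable_comp => //; [|exact: cS|].
  by apply: (cC _ _); exact: cS.
by apply: approximable_comp => //; exact: cS.
Qed.

(** Horner's scheme, one commutator per degree. The induction hypothesis is used with [j] and [u]
    exchanged, so the target itself serves as borrowed memory and one auxiliary register suffices
    for every degree. *)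
Lemma addable_horner (p : {poly R}) (c : R) (j u k : 'I_r) :
  u != j -> k != j -> k != u -> addable j (fun x => c * p.[x ord0 k]).
Proof.
elim/poly_ind: p c j u => [|p a IH] c j u uj kj ku.
  have -> : (fun x : 'rV[R]_r => c * (0 : {poly R}).[x ord0 k]) = (fun=> 0).
    by apply/funext => x; rewrite horner0 mulr0.
  exact: addable_cst.
have -> : (fun x : 'rV[R]_r => c * (p * 'X + a%:P).[x ord0 k]) =
    (fun x => x ord0 k * (c * p.[x ord0 k]) + c * a).
  by apply/funext => x; rewrite hornerMXaddC; ring.
apply: addableD; last exact: addable_cst.
apply: (addable_commutator j u k (fun x => c * p.[x ord0 k])) => //.
- by move=> x t; rewrite !mxE (negbTE kj) andbF mulr0 addr0.
- by apply: (IH c u j) => //; rewrite eq_sym.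
- have -> : (fun x : 'rV[R]_r => - (c * p.[x ord0 k])) =
      (fun x => - c * p.[x ord0 k]) by apply/funext => x; ring.
  by apply: (IH (- c) u j) => //; rewrite eq_sym.
Qed.

Lemma addable_univariate (h : R -> R) (j u k : 'I_r) : continuous h ->
  u != j -> k != j -> k != u -> addable j (fun x => h (x ord0 k)).
Proof.
move=> ch uj kj ku; apply: addable_limit.
- move=> x; apply: (@continuous_comp _ _ _ (fun x : 'rV[R]_r => x ord0 k) h).
    exact: coord_continuous.
  exact: ch.
- by move=> x t; rewrite !mxE (negbTE kj) andbF mulr0 addr0.
- move=> B eta eta0; have [p Hp] := weierstrass h B eta ch eta0.
  exists (fun x => 1 * p.[x ord0 k]); first exact: (addable_horner p 1 j u k).
  move=> x xB; rewrite mul1r; apply: Hp.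
  by move/(rV_norm_leP x B (le_trans (normr_ge0 _) xB)): xB.
Qed.

Lemma addable_sum (j : 'I_r) (I : finType) (phi : I -> 'rV[R]_r -> R) :
  (forall i, addable j (phi i)) -> addable j (fun x => \sum_i phi i x).
Proof.
move=> H; elim: (index_enum I) => [|i s IH].
  by under eq_fun do rewrite big_nil; exact: addable_cst.
by under eq_fun do rewrite big_cons; exact: addableD.
Qed.

(** No [phi i] reads a register that is written to, so the shears can be carried out one after
    another without interference. *)
Lemma approximable_addable_seq (I : eqType) (s : seq I) (j : I -> 'I_r)
    (phi : I -> 'rV[R]_r -> R) : (forall i, addable (j i) (phi i)) ->
  (forall i i' x t, phi i (x + t *: e_ (j i')) = phi i x) ->
  continuous (fun x : 'rV[R]_r => x + \sum_(i <- s) phi i x *: e_ (j i)) /\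
  approximable (fun x : 'rV[R]_r => x + \sum_(i <- s) phi i x *: e_ (j i)).
Proof.
move=> H inv; elim: s => [|i s [IHc IHa]].
  under eq_fun do rewrite big_nil addr0; split; first by move=> x; exact: cvg_id.
  (* The identity is the shear by 0 on some register; when [r] is 0 there is none, and a neuron with
     zero output weight is used. *)
  have [j0|r0] := pickP 'I_r.
    have [_ _] := addable_cst j0 0.
    by under eq_fun do rewrite scale0r addr0.
  have := approximable_neuron sigma t0 r sigma_derivable sigma_slope 0 0 0.
  by under eq_fun do rewrite scaler0 addr0.
have [ci _ ai] := H i.
have inv_sum x : phi i (x + \sum_(i <- s) phi i x *: e_ (j i)) = phi i x.
  elim: s {IHc IHa} => [|i' s IH']; first by rewrite big_nil addr0.
  by rewrite big_cons addrCA addrC inv.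
have -> : (fun x : 'rV[R]_r => x + \sum_(i0 <- (i :: s)) phi i0 x *: e_ (j i0)) =
  (fun x => x + phi i x *: e_ (j i)) \o
  (fun x => x + \sum_(i <- s) phi i x *: e_ (j i)).
  by apply/funext => x /=; rewrite inv_sum big_cons -addrA [_ + phi i x *: _]addrC.
have ci' := continuous_shear r (j i) (phi i) ci.
split; last exact: approximable_comp.
by move=> x; apply: continuous_comp; [exact: IHc|exact: ci'].
Qed.

End register_programs.

(** * Superposition sums, extension and density *)

(** The registers are [n] inputs, [m] outputs and one auxiliary, and the free neuron brings the
    width to [n + m + 2]. For [n = 2 * M + 1] this is [2 * M + m + 3]. *)
Lemma kolmogorov_sum_approximable {R : realType} (sigma : R -> R) (t0 : R) (n m : nat)
    (h : 'I_m -> 'I_n -> R -> R) :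
  continuous sigma -> derivable sigma t0 1 -> derive1 sigma t0 != 0 ->
  ~ (exists a b : R, forall t, sigma t = a * t + b) ->
  (forall i q, continuous (h i q)) ->
  approximable sigma (n + (m + 1)).+1
    (fun x : 'rV[R]_n => \row_i \sum_q h i q (x ord0 q)).
Proof.
move=> csig dsig slope naff ch B eta eta0.
pose inp (q : 'I_n) : 'I_(n + (m + 1)) := lshift (m + 1) q.
pose out (i : 'I_m) : 'I_(n + (m + 1)) := rshift n (lshift 1 i).
pose aux : 'I_(n + (m + 1)) := rshift n (rshift m ord0).
have inp_out q i : inp q != out i by rewrite eq_lrshift.
have inp_aux q : inp q != aux by rewrite eq_lrshift.
have aux_out i : aux != out i.
  by rewrite (inj_eq (@rshift_inj _ _)) eq_rlshift.
pose phi i (x : 'rV[R]_(n + (m + 1))) := \sum_q h i q (x ord0 (inp q)).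
have add_phi i : addable sigma (n + (m + 1)) (out i) (phi i).
  apply: (addable_sum sigma t0) => // q.
  exact: (addable_univariate sigma t0 _ csig dsig slope naff (h i q) (out i) aux).
have inv i i' x t : phi i (x + t *: delta_mx ord0 (out i')) = phi i x.
  apply: eq_bigr => q _; congr (h i q _).
  by rewrite !mxE (negbTE (inp_out q i')) andbF mulr0 addr0.
have [_ app] := approximable_addable_seq sigma t0 _ csig dsig slope naff
  'I_m (index_enum _) out phi add_phi inv.
have [g ng Hg] := app B eta eta0.
(* [W] loads the inputs and clears the other registers; [W'] reads the outputs. *)
pose W : 'M[R]_(n, n + (m + 1)) := row_mx 1%:M 0.
pose W' : 'M[R]_(n + (m + 1), m) := col_mx 0 (col_mx 1%:M 0).
exists (fun x => g (x *m W) *m W'); first exact: network_affine.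
move=> x xB.
have WE q : (x *m W) ord0 (inp q) = x ord0 q.
  by rewrite mul_mx_row mulmx1 row_mxEl.
have W0 i : (x *m W) ord0 (out i) = 0.
  by rewrite mul_mx_row mulmx0 row_mxEr mxE.
have W'E (y : 'rV[R]_(n + (m + 1))) i : (y *m W') ord0 i = y ord0 (out i).
  rewrite -[y]hsubmxK mul_row_col mulmx0 add0r row_mxEr.
  by rewrite -[rsubmx y]hsubmxK mul_row_col mulmx0 addr0 mulmx1 row_mxEl.
have B0 : 0 <= B by apply: le_trans xB.
have xWB : `|x *m W| <= B.
  apply/rV_norm_leP => // j; rewrite mul_mx_row mulmx1 mulmx0 mxE.
  by case: splitP => k _; rewrite ?mxE ?normr0//; move/(rV_norm_leP x B B0): xB.
apply/rV_norm_leP; [exact: ltW|move=> i].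
move/(rV_norm_leP _ eta (ltW eta0)): (Hg _ xWB) => /(_ (out i)).
congr (_ <= _); congr `| _ |.
rewrite [LHS]mxE [X in _ + X = _]mxE [X in X + _ = _]mxE W0 add0r.
rewrite [RHS]mxE [X in _ = _ + X]mxE W'E [X in _ = X + _]mxE; congr (_ - _).
rewrite summxE (bigD1 i)//= big1 ?addr0 => [|i' i'i].
  by rewrite !mxE !eqxx mulr1; apply: eq_bigr => q _; rewrite WE.
rewrite !mxE (inj_eq (@rshift_inj _ _)) (inj_eq (@lshift_inj _ _)) eq_sym.
by rewrite (negbTE i'i) mulr0.
Qed.

(** Tietze's theorem for each coordinate: compact Hausdorff spaces are normal, [K] is closed, and
    [g] is bounded on it. *)
Lemma compact_extension {R : realType} {X : topologicalType} {m : nat} (K : set X)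
    (g : X -> 'rV[R]_m) : hausdorff_space X -> compact [set: X] -> compact K ->
  {within K, continuous g} -> forall i, exists f : X -> R,
    continuous f /\ forall x, K x -> f x = g x ord0 i.
Proof.
move=> hX cX cK cg i.
have cgi : {within K, continuous (fun x => g x ord0 i : R^o)}.
  move=> x; apply: (@continuous_comp _ _ _ (g : subspace K -> 'rV[R]_m)
    (fun v : 'rV[R]_m => v ord0 i : R^o)); [exact: cg|exact: coord_continuous].
have /compact_bounded[C [_ HC]] := continuous_compact cgi cK.
have C0 : 0 < `|C| + 1 by rewrite ltr_wpDl.
have [|f [fE cf _]] := continuous_bounded_extension (compact_normal hX cX)
  (compact_closed hX cK) C0 cgi.
  by move=> x Kx; apply: HC; [have := ler_norm C; lra|exists x].
exists f; split => // x Kx; apply/esym/fE; exact/mem_set.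
Qed.

(** The norm on the right is the maximum norm; the factor [m] in place of its square root costs only
    [m <= m ^ 2]. *)
Lemma enorm_le {R : realType} {m : nat} (v : 'rV[R]_m) : enorm v <= m%:R * `|v|.
Proof.
have v0 : 0 <= m%:R * `|v| by rewrite mulr_ge0.
rewrite -[leRHS]ger0_norm// -sqrtr_sqr; apply: ler_wsqrtr.
case: m v v0 => [|m] v _; first by rewrite big_ord0 sqr_ge0.
apply: (@le_trans _ _ (\sum_(i < m.+1) `|v| ^+ 2)).
  apply: ler_sum => i _; rewrite -[v ord0 i ^+ 2]real_normK ?num_real//.
  apply: lerXn2r; rewrite ?nnegrE//.
  by have := lexx `|v|; move/(rV_norm_leP v _ (normr_ge0 v)).
rewrite sumr_const card_ord -[leLHS]mulr_natl exprMn ler_wpM2r ?sqr_ge0//.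
by rewrite -natrX ler_nat expnS leq_pmulr// expn_gt0.
Qed.

Theorem theorem3p4 (R : realType) (n0 : nat) (Xp : 'I_n0 -> metricType R)
  (d : 'I_n0 -> nat) (M : nat)
  (Xp_compact : forall p, compact [set: Xp p])
  (Xp_dim : forall p, topdim (Xp p) (d p))
  (M_def : M = (\sum_(p < n0) d p)%N)
  (psi : forall p : 'I_n0, 'I_(2 * M + 1) -> Xp p -> R)
  (psi_cont : forall p q, continuous (psi p q))
  (psi_range : forall p q x, 0 <= psi p q x <= 1)
  (psi_repr : forall f : prod_topology Xp -> R, continuous f ->
     exists h : 'I_(2 * M + 1) -> R -> R,
       (forall q, continuous (h q)) /\
       forall x : prod_topology Xp,
         f x = \sum_(q < 2 * M + 1) h q (\sum_(p < n0) psi p q (x p)))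
  (s : 'I_(2 * M + 1) -> prod_topology Xp -> R)
  (s_def : forall q x, s q x = \sum_(p < n0) psi p q (x p))
  (F : prod_topology Xp -> 'rV[R]_(2 * M + 1))
  (F_def : forall x, F x = \row_q s q x)
  (A : set (prod_topology Xp -> R))
  (A_cont : forall f, A f -> continuous f)
  (A_s : forall q, A (s q))
  (sigma : R -> R)
  (sigma_cont : continuous sigma)
  (sigma_nonaffine : ~ exists a b : R, forall t, sigma t = a * t + b)
  (sigma_diff : exists (t0 : R) (U : set R),
     [/\ open U, U t0, (forall t, U t -> derivable sigma t 1),
         {for t0, continuous (derive1 sigma)} & derive1 sigma t0 != 0]) :
  forall (m : nat), (1 <= m)%N ->
  forall (K : set (prod_topology Xp)), compact K ->
  forall (g : prod_topology Xp -> 'rV[R]_m), {within K, continuous g} ->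
  forall eps : R, 0 < eps ->
  exists H, NN (2 * M + m + 3) sigma F H /\
    exists2 c : R, c < eps & forall x, K x -> enorm (g x - H x) <= c.
Proof.
move=> m m1 K cK g cg eps eps0.
have [t0 [U [oU Ut0 dU _ slope]]] := sigma_diff.
have dsig : derivable sigma t0 1 by exact: dU.
have cX : compact [set: prod_topology Xp].
  have := tychonoff (fun p => Xp_compact p).
  by congr compact; apply/seteqP; split.
have hX : hausdorff_space (prod_topology Xp).
  by apply: hausdorff_product => p; exact: metric_hausdorff.
have ext (i : 'I_m) : exists h : 'I_(2 * M + 1) -> R -> R,
    (forall q, continuous (h q)) /\
    forall x, K x -> g x ord0 i = \sum_q h q (s q x).
  have [f [cf fE]] := compact_extension K g hX cX cK cg i.
  have [h [ch hE]] := psi_repr f cf.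
  exists h; split=> // x Kx; rewrite -fE// hE.
  by apply: eq_bigr => q _; rewrite s_def.
have {ext} [h hP] := choice ext.
have m0 : 0 < m%:R :> R by rewrite ltr0n.
(* The divisor [m] absorbs the factor of [enorm_le]; the half leaves room for a strict bound on the
   supremum. *)
have eta0 : 0 < eps / 2 / m%:R by rewrite !divr_gt0.
(* The radius is [n0] because each [s q] is a sum of [n0] terms in [[0, 1]]. *)
have [G [N [hN wN GE]] HG] := kolmogorov_sum_approximable sigma t0 (2 * M + 1) m h
  sigma_cont dsig slope sigma_nonaffine (fun i => (hP i).1) n0%:R _ eta0.
exists (G \o F); split.
  exists N; split => //; last by move=> x; exact: GE.
  by apply: leq_trans wN _; lia.
exists (eps / 2); first by lra.
move=> x Kx; apply: le_trans (enorm_le _) _.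
rewrite mulrC -ler_pdivlMr//.
have FB : `|F x| <= n0%:R.
  apply/rV_norm_leP => // q; rewrite F_def mxE s_def.
  apply: (le_trans (ler_norm_sum _ _ _)).
  apply: (@le_trans _ _ (\sum_(p < n0) (1 : R))).
    apply: ler_sum => p _; have /andP[h0 h1] := psi_range p q (x p).
    by rewrite ger0_norm.
  by rewrite sumr_const card_ord.
have := HG (F x) FB; congr (`| _ - _ | <= _).
apply/rowP => i; rewrite mxE (hP i).2//.
by apply: eq_bigr => q _; rewrite F_def mxE.
Qed.
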